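(* Let $K,d,S,N$ be positive integers with $S+2\le N\le d(K-1)+S$, let $C\triangleq d(K-1)+S+1-N$, let $\boldsymbol{\mathcal{N}}=\{\mathcal{N}_g:g\in[G]\}$ be a pre-specified non-straggler pattern with intersection $\mathcal{I}=\bigcap_{g\in[G]}\mathcal{N}_g$, $I=|\mathcal{I}|$, and $L\triangleq N-S-I$. Let $\boldsymbol{w}\in\mathbb{C}^K$ with all $w_k\neq0$. Define $$I^*=\begin{cases}\lfloor (K-1)/2\rfloor+1, & d=1,\\ (d-1)(K-1)+1, & d\ge 2.\end{cases}$$ Then for a fixed generic pairwise distinct set of data points $\{\alpha_k\in\mathbb{C}:k\in[K]\}$ (i.e. chosen outside a proper algebraic variety of $\mathbb{C}^K$ determined by $K,N,d,S,\boldsymbol{w}$): (1) There exist pairwise distinct values $\{\beta_n:n\in\mathcal{I}\}\subseteq\mathbb{C}$ with $\{\beta_n:n\in\mathcal{I}\}\cap\{\alpha_k:k\in[K]\}=\emptyset$ such that $$\sum_{k=0}^{K-1}w_k\,P_{\mathcal{I}}(\alpha_k)\,\alpha_k^j=0\ \text{ for all } j\in[C+L],\qquad P_{\mathcal{I}}(z)\triangleq\prod_{n\in\mathcal{I}}(z-\beta_n),$$ if and only if $I\ge I^*$. (2) If $I\ge I^*$, then there exist pairwise distinct evaluation points $\{\beta_n:n\in[N]\}$ with $\{\alpha_k:k\in[K]\}\cap\{\beta_n:n\in[N]\}=\emptyset$ such that $\sum_{k=0}^{K-1}w_kP_g(\alpha_k)\alpha_k^j=0$ for all $j\in[C]$,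 $g\in[G]$, where $P_g(z)\triangleq\prod_{n\in\mathcal{N}_g}(z-\beta_n)$; hence the CPA scheme with these points is feasible over $\boldsymbol{\mathcal{N}}$.
   Context: Notation: for a positive integer $m$, $[m]=\{0,1,\dots,m-1\}$. A master and $N$ workers indexed by $[N]$. Given $K$ data matrices $\boldsymbol{X}_k\in\mathbb{C}^{q\times v}$, a polynomial $F$ of degree $d$ acting entry-wise, and weights $w_k\neq0$, the goal is $\boldsymbol{Y}=\sum_{k=0}^{K-1}w_kF(\boldsymbol{X}_k)$. A non-straggler pattern is a collection $\boldsymbol{\mathcal{N}}=\{\mathcal{N}_g:g\in[G]\}$ of subsets of $[N]$ each of cardinality $N-S$. A CPA scheme: the master uses pairwise distinct data points $\alpha_k$ and the encoder polynomial $E(z)$ of degree at most $K-1$ with $E(\alpha_k)=\boldsymbol{X}_k$, pairwise distinct evaluation points $\beta_n$ (disjoint from the $\alpha_k$), sends $E(\beta_n)$ to worker $n$, who returns $F(E(\beta_n))$; on receiving responses from $\mathcal{N}\in\boldsymbol{\mathcal{N}}$, the master interpolates $D(z)$ of degree at most $N-S-1$ with $D(\beta_n)=F(E(\beta_n))$ for $n\in\mathcal{N}$ and outputs $\widehat{\boldsymbol{Y}}(\mathcal{N})=\sum_kw_kD(\alpha_k)$. The scheme is feasible over $\boldsymbol{\mathcal{N}}$ if $\widehat{\boldsymbol{Y}}(\mathcal{N})=\boldsymbol{Y}$ for all $\mathcal{N}\in\boldsymbol{\mathcal{N}}$ (for all data matrices). *)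

(* Defs.v *)
From HB Require Import structures.
From mathcomp Require Import all_boot all_order all_algebra.
From mathcomp Require Import Rstruct.
From mathcomp Require Import complex.
From mathcomp Require Import mpoly.
Set Implicit Arguments. Unset Strict Implicit. Unset Printing Implicit Defensive.
Import GRing.Theory.
Local Open Scope ring_scope.

Definition CC : numClosedFieldType := complex Rdefinitions.R.

Definition Istar (K d : nat) : nat :=
  if d == 1%N then ((K - 1)./2 + 1)%N else ((d - 1) * (K - 1) + 1)%N.

Definition pattern_inter (N : nat) (P : {set {set 'I_N}}) : {set 'I_N} :=
  \bigcap_(A in P) A.

Definition is_pattern (N S : nat) (P : {set {set 'I_N}}) : Prop :=
  P != set0 /\ forall A, A \in P -> #|A| = (N - S)%N.

(* Encoder polynomial E(z) of degree <= K-1 with E(alpha_k) = X_k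
   (Lagrange form), evaluated at z. *)
Definition encoder (K q v : nat) (alpha : 'I_K -> CC) (X : 'I_K -> 'M[CC]_(q, v))
    (z : CC) : 'M[CC]_(q, v) :=
  \sum_(k < K) (\prod_(k' < K | k' != k) ((z - alpha k') / (alpha k - alpha k'))) *: X k.

Definition Fmx (q v : nat) (F : {poly CC}) (M : 'M[CC]_(q, v)) : 'M[CC]_(q, v) :=
  map_mx (fun x => F.[x]) M.

(* Decoder: the interpolant D(z) of degree <= |A|-1 with D(beta_n) = Y_n for
   n in A (Lagrange form), evaluated at z. *)
Definition decoder (N q v : nat) (beta : 'I_N -> CC) (A : {set 'I_N})
    (Yr : 'I_N -> 'M[CC]_(q, v)) (z : CC) : 'M[CC]_(q, v) :=
  \sum_(n in A)
    (\prod_(m in A | m != n) ((z - beta m) / (beta n - beta m))) *: Yr n.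

Definition cpa_output (K N q v : nat) (F : {poly CC}) (w : 'I_K -> CC)
    (alpha : 'I_K -> CC) (beta : 'I_N -> CC) (X : 'I_K -> 'M[CC]_(q, v))
    (A : {set 'I_N}) : 'M[CC]_(q, v) :=
  \sum_(k < K) w k *:
     decoder beta A (fun n => Fmx F (encoder alpha X (beta n))) (alpha k).

Definition cpa_target (K q v : nat) (F : {poly CC}) (w : 'I_K -> CC)
    (X : 'I_K -> 'M[CC]_(q, v)) : 'M[CC]_(q, v) :=
  \sum_(k < K) w k *: Fmx F (X k).

Definition cpa_feasible (K N : nat) (F : {poly CC}) (w : 'I_K -> CC)
    (alpha : 'I_K -> CC) (beta : 'I_N -> CC) (P : {set {set 'I_N}}) : Prop :=
  forall (q v : nat) (X : 'I_K -> 'M[CC]_(q, v)) (A : {set 'I_N}),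
    A \in P -> cpa_output F w alpha beta X A = cpa_target F w X.

(* Main.v *)
Require Import Defs.
From HB Require Import structures.
From mathcomp Require Import all_boot all_order all_algebra.
From mathcomp Require Import separable zify ring.
From mathcomp Require Import Rstruct complex mpoly.
Set Implicit Arguments. Unset Strict Implicit. Unset Printing Implicit Defensive.
Import GRing.Theory Num.Theory.
Local Open Scope ring_scope.

(** Put m = K - 1, so that C + L = d m + 1 - I, and let Q be the monic
    polynomial P_I of degree I; the conditions say that the functional
    r |-> \sum_k w_k Q(alpha_k) r(alpha_k) kills all r of degree < C + L.

    Necessity. If C + L >= K, a Vandermonde argument forces Q(alpha_k) = 0. The
    only other case is d = 1 with I + 1 <= C + L; then the coefficients of Q are
    in the kernel of the Hankel matrix of order I + 1 of the moments
    \sum_k w_k alpha_k^s, which is invertible for generic alpha.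

    Sufficiency. For d = 1 one takes for Q the orthogonal polynomial of degree I
    of the weights w at the nodes alpha; for generic alpha it exists, has simple
    roots and does not vanish at the nodes. For d >= 2 there is room (I >= K) to
    take Q = M + c R, where R(alpha_k) is the Lagrange residue at alpha_k divided
    by w_k, M is a multiple of \prod_k (z - alpha_k), and c is a constant
    outside a finite set.

    Genericity is witnessed at degenerate configurations, in which all the nodes
    but a few collapse to 0; weights then add up, and the point is to choose the
    collapsing nodes so that their total weight is nonzero.

    For (2), F(E(z)) - D(z) is a multiple of P_g whose cofactor has degree < C. *)

(** * Moments, Hankel matrices and orthogonal polynomials *)

Lemma size_prod_XsubC_set {R : comNzRingType} {J : finType} (B : {set J}) (a : J -> R) :
  size (\prod_(i in B) ('X - (a i)%:P)) = #|B|.+1.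
Proof. by rewrite -big_enum size_prod_XsubC -cardE. Qed.

Lemma horner_prod_XsubC_set {R : comNzRingType} {J : finType} (B : {set J})
    (a : J -> R) x :
  (\prod_(i in B) ('X - (a i)%:P)).[x] = \prod_(i in B) (x - a i).
Proof. by rewrite horner_prod; apply: eq_bigr => i _; rewrite hornerXsubC. Qed.

Section Moments.
Context {R : comNzRingType} {J : finType}.
Implicit Types (a u y : J -> R) (q r : {poly R}).

Lemma moments_horner a y n r :
  (forall j, (j < n)%N -> \sum_k y k * a k ^+ j = 0) -> (size r <= n)%N ->
  \sum_k y k * r.[a k] = 0.
Proof.
move=> y0 rn; under eq_bigr => k _ do rewrite (horner_coef_wide _ rn) mulr_sumr.
rewrite exchange_big /= big1 // => i _.
under eq_bigr => k _ do rewrite mulrCA.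
by rewrite -mulr_sumr y0 ?mulr0.
Qed.

Definition moment u a (s : nat) : R := \sum_k u k * a k ^+ s.

Definition hankel n u a : 'M[R]_n := \matrix_(i, j) moment u a (i + j).

Lemma mul_hankel n u a (v : 'rV[R]_n) (j : 'I_n) :
  (v *m hankel n u a) 0 j = \sum_k u k * (rVpoly v).[a k] * a k ^+ j.
Proof.
have sv : (size (rVpoly v) <= n)%N by apply: size_poly.
rewrite mxE; under [RHS]eq_bigr => k _ do
  rewrite (horner_coef_wide _ sv) -mulrA mulr_suml mulr_sumr.
rewrite exchange_big /=; apply: eq_bigr => i _; rewrite mxE mulr_sumr.
by apply: eq_bigr => k _; rewrite coef_rVpoly_ord mulrCA exprD !mulrA.
Qed.

(* Up to the factor [\det H], the monic polynomial of degree [n] orthogonal to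
   all polynomials of degree < n for the functional r |-> \sum_k u_k r(a_k);
   the adjugate keeps its coefficients polynomial in the nodes. *)
Definition orthopoly n u a : {poly R} :=
  \det (hankel n u a) *: 'X^n -
  rVpoly ((\row_(j < n) moment u a (n + j)) *m \adj (hankel n u a)).

(** As [\adj H *m H] is the scalar [\det H], the lower-order terms cancel the moments of the leading
    one without any division. *)
Lemma orthopolyP n u a j : (j < n)%N ->
  \sum_k u k * (orthopoly n u a).[a k] * a k ^+ j = 0.
Proof.
move=> jn; rewrite /orthopoly; set h := \row_ _ _; set H := hankel n u a.
have e := mul_hankel u a (h *m \adj H) (Ordinal jn).
rewrite -/H -mulmxA mul_adj_mx mul_mx_scalar !mxE /= in e.
under eq_bigr => k _ do rewrite hornerD hornerN hornerZ hornerXn mulrBr mulrBl.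
rewrite sumrB -e /moment mulr_sumr; apply/eqP; rewrite subr_eq0; apply/eqP.
by apply: eq_bigr => k _; rewrite exprD mulrCA !mulrA.
Qed.

Lemma coef_orthopoly n u a : (orthopoly n u a)`_n = \det (hankel n u a).
Proof.
rewrite coefB coefZ coefXn eqxx mulr1 nth_default ?subr0 //.
exact: size_poly.
Qed.

Lemma size_orthopoly_leq n u a : (size (orthopoly n u a) <= n.+1)%N.
Proof.
apply: leq_trans (size_polyD _ _) _; rewrite geq_max size_polyN; apply/andP; split.
  by apply: leq_trans (size_scale_leq _ _) _; rewrite size_polyXn.
by apply: leqW; apply: size_poly.
Qed.

Lemma size_orthopoly n u a : \det (hankel n u a) != 0 -> size (orthopoly n u a) = n.+1.
Proof.
move=> H; apply/eqP; rewrite eqn_leq size_orthopoly_leq ltnNge.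
by apply: contraNN H => /leq_sizeP h; rewrite -coef_orthopoly h.
Qed.

Lemma lead_coef_orthopoly n u a :
  \det (hankel n u a) != 0 -> lead_coef (orthopoly n u a) = \det (hankel n u a).
Proof. by move=> H; rewrite lead_coefE size_orthopoly // coef_orthopoly. Qed.

End Moments.

Section Morphism.
Context {R R' : comNzRingType} {J : finType} (f : {rmorphism R -> R'}).
Implicit Types (a u : J -> R).

Lemma rmorph_moment u a s : f (moment u a s) = moment (f \o u) (f \o a) s.
Proof. by rewrite rmorph_sum; apply: eq_bigr => k _; rewrite rmorphM rmorphXn. Qed.

Lemma map_hankel n u a : map_mx f (hankel n u a) = hankel n (f \o u) (f \o a).
Proof. by apply/matrixP=> i j; rewrite !mxE rmorph_moment. Qed.

Lemma rmorph_det_hankel n u a :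
  f (\det (hankel n u a)) = \det (hankel n (f \o u) (f \o a)).
Proof. by rewrite -det_map_mx map_hankel. Qed.

Lemma map_orthopoly n u a :
  map_poly f (orthopoly n u a) = orthopoly n (f \o u) (f \o a).
Proof.
rewrite /orthopoly rmorphB /= map_polyZ map_polyXn rmorph_det_hankel.
rewrite map_rVpoly map_mxM map_mx_adj map_hankel; congr (_ - rVpoly (_ *m _)).
by apply/rowP=> j; rewrite !mxE rmorph_moment.
Qed.

(* [map_resultant] only covers morphisms out of a polynomial ring. *)
Lemma rmorph_resultant (p q : {poly R}) :
  size (map_poly f p) = size p -> size (map_poly f q) = size q ->
  f (resultant p q) = resultant (map_poly f p) (map_poly f q).
Proof.
move=> fp fq; rewrite /resultant -det_map_mx /Sylvester_mx fp fq map_col_mx.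
by congr (\det (col_mx _ _)); apply: map_lin1_mx => v;
  rewrite /= map_poly_rV rmorphM /= map_rVpoly.
Qed.

End Morphism.

Section HankelField.
Context {F : fieldType} {J : finType}.
Implicit Types (a u y : J -> F).

(** By [mul_hankel], a row in the kernel of the Hankel matrix is the coefficient row of such a
    [q]. *)
Lemma det_hankel_neq0P n u a :
  reflect (forall q : {poly F}, (size q <= n)%N ->
             (forall j, (j < n)%N -> \sum_k u k * q.[a k] * a k ^+ j = 0) -> q = 0)
          (\det (hankel n u a) != 0).
Proof.
apply: (iffP idP) => [H q qn q0|H].
  apply/eqP; apply: contraNT H => q_neq0; apply/det0P; exists (poly_rV q).
    apply: contra_neq q_neq0 => v0.
    by rewrite -(poly_rV_K qn) v0 linear0.
  by apply/rowP=> j; rewrite mul_hankel poly_rV_K // q0 // mxE.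
apply/negP=> /det0P[v v0 vH]; case/eqP: v0; rewrite -(rVpolyK v).
rewrite (H (rVpoly v)) ?linear0 ?size_poly // => j jn.
by rewrite -[j]/(nat_of_ord (Ordinal jn)) -mul_hankel vH mxE.
Qed.

(** Testing against the product of the ['X - a i] over [B :\ k] isolates [y k]. Asking injectivity
    on [B] only lets the other nodes coincide. *)
Lemma vandermonde_vanish (B : {set J}) a y :
  {in B &, injective a} -> (forall k, k \notin B -> y k = 0) ->
  (forall j, (j < #|B|)%N -> \sum_k y k * a k ^+ j = 0) -> forall k, y k = 0.
Proof.
move=> aB y0 ys k; have [kB|/y0//] := boolP (k \in B).
pose r := \prod_(i in B :\ k) ('X - (a i)%:P).
have rB : (size r <= #|B|)%N by rewrite size_prod_XsubC_set (cardsD1 k B) kB.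
have rk : r.[a k] != 0.
  rewrite horner_prod_XsubC_set; apply/prodf_neq0 => i; rewrite !inE subr_eq0.
  by move=> /andP[ik iB]; apply: contraNneq ik => /aB->.
have /eqP := moments_horner ys rB.
rewrite (bigD1 k) //= big1 ?addr0 ?mulf_eq0 ?(negbTE rk) ?orbF => [/eqP//|i ik].
have [iB|/y0->] := boolP (i \in B); last by rewrite mul0r.
by rewrite horner_prod_XsubC_set (bigD1 i) ?inE ?ik //= subrr mul0r mulr0.
Qed.

Lemma moments_vanish n a y : injective a -> (#|J| <= n)%N ->
  (forall j, (j < n)%N -> \sum_k y k * a k ^+ j = 0) -> forall k, y k = 0.
Proof.
move=> ia Jn ys; apply: (@vandermonde_vanish setT a) => [i j _ _||j]; first exact: ia.
  by move=> k; rewrite inE.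
by rewrite cardsT => jJ; apply: ys; apply: leq_trans jJ Jn.
Qed.

Lemma poly_vanish_on (B : {set J}) a (q : {poly F}) : {in B &, injective a} ->
  (size q <= #|B|)%N -> (forall k, k \in B -> q.[a k] = 0) -> q = 0.
Proof.
move=> aB qB q0; apply/eqP; apply: contraTT qB => q_neq0; rewrite -ltnNge.
have -> : #|B| = size (map a (enum B)) by rewrite size_map cardE.
apply: max_poly_roots => //.
  by apply/allP=> x /mapP[k]; rewrite mem_enum => kB ->; apply/rootP/q0.
by rewrite map_inj_in_uniq ?enum_uniq // => i j; rewrite !mem_enum; apply: aB.
Qed.

Section Support.
Variables (B : {set J}) (u a : J -> F).
Hypothesis aB : {in B &, injective a}.
Hypothesis u0 : forall k, k \notin B -> u k = 0.
Hypothesis uB : forall k, k \in B -> u k != 0.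

Lemma orthogonal_vanish (q : {poly F}) :
  (forall j, (j < #|B|)%N -> \sum_k u k * q.[a k] * a k ^+ j = 0) ->
  forall k, k \in B -> q.[a k] = 0.
Proof.
move=> qs k kB; apply/eqP; rewrite -(mulrI_eq0 _ (mulfI (uB kB))); apply/eqP.
apply: (@vandermonde_vanish B a (fun k => u k * q.[a k])) => // i /u0->.
exact: mul0r.
Qed.

Lemma hankel_support : \det (hankel #|B| u a) != 0.
Proof.
by apply/det_hankel_neq0P=> q qB /orthogonal_vanish; apply: poly_vanish_on.
Qed.

Lemma orthopoly_support k : k \in B -> (orthopoly #|B| u a).[a k] = 0.
Proof. by apply: orthogonal_vanish => j; apply: orthopolyP. Qed.

End Support.

Lemma eq_hankel u u' a a' n : moment u a =1 moment u' a' ->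
  hankel n u a = hankel n u' a'.
Proof. by move=> e; apply/matrixP=> i j; rewrite !mxE e. Qed.

Lemma eq_orthopoly u u' a a' n : moment u a =1 moment u' a' ->
  orthopoly n u a = orthopoly n u' a'.
Proof.
move=> e; rewrite /orthopoly (eq_hankel n e); congr (_ - rVpoly (_ *m _)).
by apply/rowP=> j; rewrite !mxE e.
Qed.

(* Merging the nodes outside [A], all located at a point [k0], moves their
   total weight to [k0]. *)
Lemma moment_merge (A : {set J}) k0 u a : k0 \notin A ->
  (forall k, k \notin A -> a k = a k0) ->
  moment u a =1 moment (fun k => if k \in A then u k else
                        if k == k0 then \sum_(i in ~: A) u i else 0) a.
Proof.
move=> k0A aA s; rewrite /moment (bigID (mem A)) [RHS](bigID (mem A)) /=.
congr (_ + _); first by apply: eq_bigr => k ->.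
rewrite [RHS](bigD1 k0) //= (negbTE k0A) eqxx [\sum_(_ | _ && _) _]big1 ?addr0.
  rewrite mulr_suml; apply: eq_big => [k|k kA]; first by rewrite inE.
  by rewrite aA.
by move=> k /andP[/negbTE-> /negbTE->]; rewrite mul0r.
Qed.

End HankelField.

Lemma subset_of_card (T : finType) (B : {set T}) n : (n <= #|B|)%N ->
  exists2 A : {set T}, A \subset B & #|A| = n.
Proof.
move=> nB; exists [set x in take n (enum B)].
  by apply/subsetP=> x; rewrite inE => /mem_take; rewrite mem_enum.
rewrite cardsE; have /card_uniqP-> := take_uniq n (enum_uniq B).
by rewrite size_take -cardE; case: ltngtP nB.
Qed.

(** * Collapsed configurations of the nodes *)

Section Special.
Context {F : numFieldType} {K : nat}.
Implicit Types (A : {set 'I_K}) (w : 'I_K -> F).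

(* If all [n]-subsets had a complement of zero weight, all weights would agree. *)
Lemma complement_sum_neq0 w n : (forall k, w k != 0) -> (0 < n < K)%N ->
  exists2 A : {set 'I_K}, #|A| = n & \sum_(k in ~: A) w k != 0.
Proof.
move=> w0 /andP[n0 nK].
case: (boolP [exists A : {set 'I_K}, (#|A| == n) && (\sum_(k in ~: A) w k != 0)]).
  by move=> /existsP[A /andP[/eqP An wA]]; exists A.
move=> /existsPn H; exfalso.
have {}H A : #|A| = n -> \sum_(k in ~: A) w k = 0.
  by move=> An; have := H A; rewrite An eqxx /= negbK => /eqP.
have eqw i j : w i = w j.
  have [->//|ij] := eqVneq i j.
  (* Adding [i] or [j] to [A'] gives two [n]-sets whose complements differ only by exchanging [i]
     and [j]; comparing the two zero sums yields [w i = w j]. *)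
  have [|A' sA A'n] := @subset_of_card _ (~: [set i; j]) n.-1.
    by have := cardsC [set i; j]; rewrite cards2 ij card_ord; lia.
  have iA : i \notin A' by apply/negP=> /(subsetP sA); rewrite !inE eqxx.
  have jA : j \notin A' by apply/negP=> /(subsetP sA); rewrite !inE eqxx orbT.
  have hi : #|i |: A'| = n by rewrite cardsU1 iA A'n; lia.
  have hj : #|j |: A'| = n by rewrite cardsU1 jA A'n; lia.
  have := H _ hi; have := H _ hj.
  rewrite (bigD1 i) ?inE ?negb_or ?ij ?iA // (bigD1 (P := mem (~: _)) j) ?inE ?negb_or 1?eq_sym ?ij ?jA //=.
  move=> /(canRL (addrK _)) -> /(canRL (addrK _)) ->; congr (_ - _).
  by apply: eq_bigl => k; rewrite !inE !negb_or; do 2 case: eqP => //=; rewrite ?andbF.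
(* The zero sum is now [K - n] times a single weight, which is nonzero in characteristic 0. *)
have [|A _ An] := @subset_of_card _ [set: 'I_K] n; first by rewrite cardsT card_ord ltnW.
pose k0 := Ordinal (leq_ltn_trans (leq0n n) nK).
have := H A An; under eq_bigr => k _ do rewrite (eqw k k0).
rewrite sumr_const => /eqP; rewrite mulrn_eq0 (negbTE (w0 _)) orbF.
by have := cardsC A; rewrite An card_ord; lia.
Qed.

Definition node A (k : 'I_K) : F := if k \in A then k.+1%:R else 0.

Lemma node_eq0 A k : (node A k == 0) = (k \notin A).
Proof. by rewrite /node; case: ifP; rewrite ?eqxx // pnatr_eq0. Qed.

Lemma node_inj A k0 : {in k0 |: A &, injective (node A)}.
Proof.
move=> i j iA jA ij; have := congr1 (fun x => x == 0) ij; rewrite !node_eq0.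
move: iA jA ij; rewrite !inE /node.
have [jA|jA] := boolP (j \in A); have [iA|iA] := boolP (i \in A) => //=.
  by move=> _ _ /eqP; rewrite eqr_nat eqSS => /eqP/val_inj.
by rewrite !orbF => /eqP-> /eqP->.
Qed.

End Special.

(** * Genericity *)

Lemma size_deriv_coef {R : nzSemiRingType} (p : {poly R}) n :
  size p = n.+1 -> p`_n *+ n != 0 -> size p^`() = n.
Proof.
case: n => [|n] sp; first by rewrite mulr0n eqxx.
move=> pn; apply/eqP; rewrite eqn_leq; apply/andP; split.
  by rewrite -ltnS -sp lt_size_deriv // -size_poly_gt0 sp.
by rewrite ltnNge; apply: contraNN pn => /leq_sizeP/(_ n (leqnn _)); rewrite coef_deriv => ->.
Qed.

Section Generic.
Context {F : numFieldType} {K : nat}.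
Variable w : 'I_K -> F.
Implicit Types (alpha : 'I_K -> F).

Let wM (k : 'I_K) : {mpoly F[K]} := (w k)%:MP.
Let xM (k : 'I_K) : {mpoly F[K]} := 'X_k.

Definition generic_det n : {mpoly F[K]} := \det (hankel n wM xM).
Definition generic_disc n : {mpoly F[K]} :=
  resultant (orthopoly n wM xM) (orthopoly n wM xM)^`().
(** By Christoffel's formula this is, up to sign, the value of the generic [orthopoly n] at the node
    [k]. *)
Definition generic_shift n k : {mpoly F[K]} :=
  \det (hankel n (fun i => wM i * (xM i - xM k)) xM).

Lemma moment_meval alpha :
  moment (meval alpha \o wM) (meval alpha \o xM) =1 moment w alpha.
Proof. by move=> s; apply: eq_bigr => k _; rewrite /= mevalC mevalXU. Qed.

Lemma meval_generic_det alpha n :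
  (generic_det n).@[alpha] = \det (hankel n w alpha).
Proof. by rewrite rmorph_det_hankel (eq_hankel _ (moment_meval alpha)). Qed.

Lemma meval_generic_shift alpha n k :
  (generic_shift n k).@[alpha] =
  \det (hankel n (fun i => w i * (alpha i - alpha k)) alpha).
Proof.
rewrite rmorph_det_hankel; congr (\det _); apply: eq_hankel => s.
by apply: eq_bigr => i _; rewrite /= rmorphM rmorphB /= mevalC !mevalXU.
Qed.

(** Evaluation commutes with the resultant because the determinant, as leading coefficient, keeps
    the degree of the polynomial and, in characteristic 0, that of its derivative. *)
Lemma meval_generic_disc alpha n : (0 < n)%N -> \det (hankel n w alpha) != 0 ->
  ((generic_disc n).@[alpha] != 0) = separable_poly (orthopoly n w alpha).
Proof.
move=> n0 H; have HM : generic_det n != 0.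
  by apply: contraNneq H => H0; rewrite -meval_generic_det H0 meval0.
have eM : map_poly (meval alpha) (orthopoly n wM xM) = orthopoly n w alpha.
  by rewrite map_orthopoly (eq_orthopoly _ (moment_meval alpha)).
have dn : (orthopoly n w alpha)`_n *+ n != 0.
  by rewrite coef_orthopoly mulrn_eq0 negb_or -lt0n n0.
have dnM : (orthopoly n wM xM)`_n *+ n != 0.
  by apply: contraNneq dn => d0; rewrite -eM coef_map -rmorphMn /= d0 meval0.
have sP := size_orthopoly H; have sPM := size_orthopoly HM.
rewrite rmorph_resultant /= -?deriv_map eM.
- rewrite resultant_eq0 -leqNgt unlock coprimep_def leq_eqVlt ltnS leqn0.
  by rewrite size_poly_eq0 gcdp_eq0 -size_poly_eq0 sP orbF.
- by rewrite sP.
by rewrite (size_deriv_coef sP) // (size_deriv_coef sPM).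
Qed.

Hypothesis w_neq0 : forall k, w k != 0.

(* Collapsing the nodes to [n] points of nonzero weight makes [orthopoly] the
   product over these points. *)
Lemma generic_disc_neq0 n : (1 < n <= K)%N ->
  generic_det n != 0 /\ generic_disc n != 0.
Proof.
move=> /andP[n1 nK].
(* Only [n.-1] nodes are kept, since the collapse point 0 is the [n]-th point. *)
have [|A An wA] := @complement_sum_neq0 _ _ w n.-1 w_neq0; first by lia.
have [k0] : exists k0, k0 \in ~: A.
  by apply/set0Pn; rewrite -card_gt0 -(ltn_add2l #|A|) cardsC card_ord; lia.
rewrite inE => k0A.
pose B := k0 |: A; pose alpha := @node F _ A; pose u := fun k =>
  if k \in A then w k else if k == k0 then \sum_(i in ~: A) w i else 0.
have Bn : #|B| = n by rewrite cardsU1 k0A; lia.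
have e : moment w alpha =1 moment u alpha.
  apply: moment_merge => // k kA.
  by rewrite /alpha /node (negbTE kA) (negbTE k0A).
have aB : {in B &, injective alpha} by apply: node_inj.
have u0 k : k \notin B -> u k = 0.
  by rewrite !inE negb_or /u => /andP[/negbTE-> /negbTE->].
have uB k : k \in B -> u k != 0.
  by rewrite !inE /u; case: ifP => //= _; rewrite orbF => ->.
have H : \det (hankel n w alpha) != 0.
  by rewrite (eq_hankel _ e) -Bn; apply: hankel_support.
have HM : generic_det n != 0.
  by apply: contraNneq H => H0; rewrite -meval_generic_det H0 meval0.
split=> //; suff : (generic_disc n).@[alpha] != 0.
  by apply: contraNneq => ->; rewrite meval0.
rewrite meval_generic_disc //; last exact: ltnW.
pose rs := map alpha (enum B).
have urs : uniq rs by rewrite map_inj_in_uniq ?enum_uniq // => i j; rewrite !mem_enum; apply: aB.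
rewrite (@all_roots_prod_XsubC _ (orthopoly n w alpha) rs) ?uniq_rootsE //.
- rewrite (eqp_separable (eqp_scale _ _)) ?separable_prod_XsubC //.
  by rewrite lead_coef_orthopoly.
- by rewrite size_orthopoly // size_map -cardE Bn.
apply/allP=> x /mapP[k]; rewrite mem_enum => kB ->; apply/rootP.
by rewrite (eq_orthopoly _ e) -Bn; apply: orthopoly_support.
Qed.

(** Collapse the nodes outside an [n]-set avoiding [k]: they all land on [alpha k], so the factor
    [alpha i - alpha k] kills their weights and no weights add up. *)
Lemma generic_shift_neq0 n k : (n < K)%N -> generic_shift n k != 0.
Proof.
move=> nK; have [|A sA An] := @subset_of_card _ (~: [set k]) n.
  by have := cardsC [set k]; rewrite cards1 card_ord; lia.
have kA : k \notin A by apply/negP=> /(subsetP sA); rewrite !inE eqxx.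
pose alpha := @node F _ A; suff : (generic_shift n k).@[alpha] != 0.
  by apply: contraNneq => ->; rewrite meval0.
have ak : alpha k = 0 by apply/eqP; rewrite node_eq0.
rewrite meval_generic_shift -An; apply: hankel_support.
- by move=> i j iA jA; apply: (@node_inj _ _ _ k); rewrite inE ?iA ?jA orbT.
- by move=> i; rewrite -(@node_eq0 F) ak subr0 => /eqP e; rewrite [alpha i]e mulr0.
by move=> i iA; rewrite ak subr0 mulf_neq0 // node_eq0 iA.
Qed.

(** The first product starts at order 2: at order 1 the Hankel determinant is the sum of the
    weights, which may be 0. *)
Definition generic_poly : {mpoly F[K]} :=
  \prod_(n < K.+1 | (1 < n)%N) (generic_det n * generic_disc n) *
  \prod_(n < K) \prod_(k < K) generic_shift n k.

Lemma generic_poly_neq0 : generic_poly != 0.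
Proof.
rewrite mulf_neq0 //; apply/prodf_neq0 => n.
  move=> n1; have [|? ?] := @generic_disc_neq0 n; last by rewrite mulf_neq0.
  by rewrite n1 -ltnS ltn_ord.
by move=> _; apply/prodf_neq0 => k _; apply: generic_shift_neq0.
Qed.

Lemma generic_polyP alpha : generic_poly.@[alpha] != 0 ->
  (forall n, (1 < n <= K)%N -> \det (hankel n w alpha) != 0 /\
     separable_poly (orthopoly n w alpha)) /\
  (forall n k, (n < K)%N ->
     \det (hankel n (fun i => w i * (alpha i - alpha k)) alpha) != 0).
Proof.
rewrite rmorphM !rmorph_prod /= mulf_eq0 negb_or => /andP[/prodf_neq0 h1 /prodf_neq0 h2].
split=> [n /andP[n1 nK]|n k nK].
  have := h1 (Ordinal (nK : (n < K.+1)%N)) n1; rewrite rmorphM /= mulf_eq0 negb_or.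
  by rewrite meval_generic_det => /andP[H]; rewrite meval_generic_disc // ltnW.
have := h2 (Ordinal nK) isT; rewrite rmorph_prod => /prodf_neq0/(_ k isT) /=.
by rewrite meval_generic_shift.
Qed.

(** If the value were 0, dividing out ['X - alpha k] would leave a polynomial of degree below [n]
    orthogonal for the shifted weights. *)
Lemma orthopoly_node_neq0 alpha n k : \det (hankel n w alpha) != 0 ->
  \det (hankel n (fun i => w i * (alpha i - alpha k)) alpha) != 0 ->
  (orthopoly n w alpha).[alpha k] != 0.
Proof.
move=> H /det_hankel_neq0P Hk; have sP := size_orthopoly H.
have P0 : orthopoly n w alpha != 0 by rewrite -size_poly_eq0 sP.
apply: contraNneq P0 => /rootP/factor_theorem[q eq].
suff q0 : q = 0 by rewrite eq q0 mul0r.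
apply: Hk => [|j jn].
  have [->|q0] := eqVneq q 0; first by rewrite size_poly0.
  by move: sP; rewrite eq size_Mmonic ?monicXsubC // size_XsubC addn2 => -[->].
rewrite -[RHS](orthopolyP w alpha jn) eq; apply: eq_bigr => i _.
by rewrite hornerM hornerXsubC [q.[_] * _]mulrC mulrA.
Qed.

End Generic.

(** * Interpolation and construction of the polynomial Q *)

Section Lagrange.
Context {F : fieldType} {J : finType}.
Implicit Types (B : {set J}) (a y : J -> F).

Definition node_prod B a n : F := \prod_(m in B :\ n) (a n - a m).

Definition lagrange B a n : {poly F} :=
  (node_prod B a n)^-1 *: \prod_(m in B :\ n) ('X - (a m)%:P).

Definition interpolant B a y : {poly F} := \sum_(n in B) y n *: lagrange B a n.

Lemma horner_lagrange B a n z :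
  (lagrange B a n).[z] = \prod_(m in B | m != n) ((z - a m) / (a n - a m)).
Proof.
rewrite hornerZ horner_prod_XsubC_set mulrC -prodf_div.
by apply: eq_bigl => m; rewrite !inE andbC.
Qed.

Lemma horner_interpolant B a y z : (interpolant B a y).[z] =
  \sum_(n in B) (\prod_(m in B | m != n) ((z - a m) / (a n - a m))) * y n.
Proof.
rewrite horner_sum; apply: eq_bigr => n _.
by rewrite hornerZ horner_lagrange mulrC.
Qed.

Lemma node_prod_neq0 B a n : {in B &, injective a} -> n \in B -> node_prod B a n != 0.
Proof.
move=> aB nB; apply/prodf_neq0 => m; rewrite !inE subr_eq0 => /andP[mn mB].
by apply: contraNneq mn => /aB->.
Qed.

Lemma interpolant_node B a y n : {in B &, injective a} -> n \in B ->
  (interpolant B a y).[a n] = y n.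
Proof.
move=> aB nB; rewrite horner_sum (bigD1 n) //= big1 => [|m /andP[mB mn]].
  rewrite addr0 !hornerZ horner_prod_XsubC_set mulVf ?mulr1 //.
  exact: node_prod_neq0.
rewrite !hornerZ horner_prod_XsubC_set (bigD1 n) ?inE 1?eq_sym ?mn //=.
by rewrite subrr mul0r !mulr0.
Qed.

Lemma size_lagrange B a n : n \in B -> (size (lagrange B a n) <= #|B|)%N.
Proof.
move=> nB; apply: leq_trans (size_scale_leq _ _) _.
by rewrite size_prod_XsubC_set (cardsD1 n B) nB.
Qed.

Lemma size_interpolant B a y : (size (interpolant B a y) <= #|B|)%N.
Proof.
apply: leq_trans (size_sum _ _ _) _; apply/bigmax_leqP => n nB.
exact: leq_trans (size_scale_leq _ _) (size_lagrange a nB).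
Qed.

Lemma interpolantK B a (r : {poly F}) : {in B &, injective a} ->
  (size r <= #|B|)%N -> interpolant B a (fun n => r.[a n]) = r.
Proof.
move=> aB rB; apply/eqP; rewrite -subr_eq0; apply/eqP.
apply: (poly_vanish_on aB) => [|n nB]; last first.
  by rewrite hornerD hornerN interpolant_node // subrr.
apply: leq_trans (size_polyD _ _) _.
by rewrite geq_max size_interpolant size_polyN.
Qed.

(* The left-hand side is the coefficient of degree [#|B|.-1] of [r]. *)
Lemma sum_residues B a (r : {poly F}) : {in B &, injective a} ->
  (size r < #|B|)%N -> \sum_(n in B) r.[a n] / node_prod B a n = 0.
Proof.
move=> aB rB; have /(congr1 (fun p : {poly F} => p`_#|B|.-1)) := interpolantK aB (ltnW rB).
rewrite [RHS]nth_default => [e|]; last by rewrite -ltnS (ltn_predK rB).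
rewrite -[RHS]e coef_sum; apply: eq_bigr => n nB; rewrite !coefZ; congr (_ * _).
suff -> : (\prod_(m in B :\ n) ('X - (a m)%:P))`_#|B|.-1 = 1 by rewrite mulr1.
have /monicP <- : \prod_(m in B :\ n) ('X - (a m)%:P) \is monic by apply: monic_prod_XsubC.
by rewrite lead_coefE size_prod_XsubC_set (cardsD1 n B) nB.
Qed.

(** The error [p - D] is divisible by the node polynomial of [B], and the moment conditions
    annihilate its cofactor, of size at most [c]. *)
Lemma weighted_interpolation {J' : finType} (w b : J' -> F) B a (p : {poly F}) c :
  {in B &, injective a} -> (size p <= #|B| + c)%N ->
  (forall j, (j < c)%N -> \sum_k w k * (\prod_(n in B) (b k - a n)) * b k ^+ j = 0) ->
  \sum_k w k * (interpolant B a (fun n => p.[a n])).[b k] = \sum_k w k * p.[b k].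
Proof.
move=> aB pB wB; set D := interpolant _ _ _.
have [q eq] : exists q, p - D = q * \prod_(x <- map a (enum B)) ('X - x%:P).
  apply: uniq_roots_prod_XsubC.
    apply/allP=> x /mapP[n]; rewrite mem_enum => nB ->; apply/rootP.
    by rewrite hornerD hornerN interpolant_node // subrr.
  rewrite uniq_rootsE map_inj_in_uniq ?enum_uniq // => m n.
  by rewrite !mem_enum; apply: aB.
rewrite big_map big_enum in eq.
have qc : (size q <= c)%N.
  have [->|q0] := eqVneq q 0; first by rewrite size_poly0.
  have : (size (p - D)%R <= #|B| + c)%N.
    apply: leq_trans (size_polyD _ _) _; rewrite geq_max pB size_polyN.
    exact: leq_trans (size_interpolant _ _ _) (leq_addr _ _).
  by rewrite eq size_Mmonic ?monic_prod_XsubC // size_prod_XsubC_set addnS addnC leq_add2l.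
apply/esym/eqP; rewrite -subr_eq0 -sumrB; apply/eqP.
rewrite -[RHS](moments_horner wB qc); apply: eq_bigr => k _.
rewrite -mulrBr -hornerN -hornerD eq hornerM horner_prod_XsubC_set.
by rewrite [q.[_] * _]mulrC mulrA.
Qed.

End Lagrange.

Lemma notin_seq {R : numDomainType} (s : seq R) : exists x, x \notin s.
Proof.
have u : uniq [seq i%:R : R | i <- iota 0 (size s).+1].
  by rewrite map_inj_uniq ?iota_uniq // => i j /eqP; rewrite eqr_nat => /eqP.
case: (boolP (all (mem s) [seq i%:R : R | i <- iota 0 (size s).+1])) => [/allP h|/allPn[x _ ?]].
  by have := uniq_leq_size u h; rewrite size_map size_iota ltnn.
by exists x.
Qed.

Lemma uniq_avoiding {R : numDomainType} (s : seq R) n :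
  exists t : seq R, [/\ uniq t, size t = n & forall x, x \in t -> x \notin s].
Proof.
elim: n => [|n [t [ut st ts]]]; first by exists [::].
have [x] := notin_seq (t ++ s); rewrite mem_cat negb_or => /andP[xt xs].
exists (x :: t); split=> /=; rewrite ?xt ?ut ?st // => y.
by rewrite inE => /orP[/eqP->|/ts].
Qed.

(** Serves to extend the points found on the intersection of the pattern to all workers, with fresh
    values outside [B]. *)
Lemma extend_injection {R : numDomainType} {J : finType} (B : {set J})
    (b : J -> R) (s : seq R) :
  {in B &, injective b} -> (forall n, n \in B -> b n \notin s) ->
  exists b' : J -> R, [/\ injective b', forall n, b' n \notin s & {in B, b' =1 b}].
Proof.
move=> bB bs; have [t [ut st ts]] := uniq_avoiding (s ++ map b (enum B)) #|J|.
pose c (n : J) := nth 0 t (enum_rank n).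
have ct n : c n \in t by rewrite mem_nth ?st.
exists (fun n => if n \in B then b n else c n); split=> [m n|n|n ->] //; last first.
  by case: ifP => [/bs//|_]; have := ts _ (ct n); rewrite mem_cat => /norP[].
have bc m' n' : m' \in B -> b m' <> c n'.
  move=> mB e; have := ts _ (ct n'); rewrite mem_cat -e => /norP[_ /negP[]].
  by rewrite map_f ?mem_enum.
have [mB|_] := boolP (m \in B); have [nB|_] := boolP (n \in B).
- exact: bB.
- by move/bc => /(_ mB).
- by move/esym/bc => /(_ nB).
by move/eqP; rewrite nth_uniq ?st // => /eqP/ord_inj/enum_rank_inj.
Qed.

(** * Separable polynomials over a closed field *)

Section ClosedField.
Context {F : numClosedFieldType} {J : finType}.

Lemma separable_factor (B : {set J}) (Q : {poly F}) :
  size Q = #|B|.+1 -> separable_poly Q ->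
  exists2 b : J -> F, {in B &, injective b} &
    forall z, Q.[z] = lead_coef Q * \prod_(n in B) (z - b n).
Proof.
move=> sQ sepQ; have Q0 : Q != 0 by rewrite -size_poly_eq0 sQ.
have [r eQ] := closed_field_poly_normal Q.
have lQ : lead_coef Q != 0 by rewrite lead_coef_eq0.
have ur : uniq r.
  by move: sepQ; rewrite eQ (eqp_separable (eqp_scale _ lQ)) separable_prod_XsubC.
have sr : size r = #|B|.
  by move: sQ; rewrite eQ size_scale // size_prod_XsubC => -[].
(* The roots are handed out along [enum B]; off [B] the index is out of range and [b] is the default
   0. *)
pose b n := nth 0 r (index n (enum B)).
have ltB n : n \in B -> (index n (enum B) < size r)%N.
  by move=> nB; rewrite sr cardE index_mem mem_enum.
exists b => [m n mB nB /eqP|z].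
  rewrite nth_uniq ?ltB // => /eqP e.
  by rewrite -(nth_index m (s := enum B) (x := m)) ?mem_enum // e nth_index ?mem_enum.
rewrite {1}eQ hornerZ; congr (_ * _); rewrite horner_prod.
have -> : r = map b (enum B).
  apply: (@eq_from_nth _ 0) => [|i ir]; first by rewrite size_map -cardE.
  have iB : (i < size (enum B))%N by rewrite -cardE -sr.
  have [n0 _] : exists n : J, true by case: (enum B) iB => // n; exists n.
  by rewrite (nth_map n0) // /b index_uniq ?enum_uniq.
by rewrite big_map big_enum; apply: eq_bigr => n _; rewrite hornerXsubC.
Qed.

(* The multiple roots of a member of the pencil [M + c R] are among the zeros of
   the Wronskian of [M] and [R], and each zero determines its [c]. *)
Lemma separable_pencil (M R : {poly F}) (s : seq F) :
  (forall z, root M z -> ~~ root R z) -> M^`() * R - M * R^`() != 0 ->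
  (size R < size M)%N -> exists2 c, c \notin s & separable_poly (M + c *: R).
Proof.
move=> coMR W0 RM; have [r eW] := closed_field_poly_normal (M^`() * R - M * R^`()).
have [c] := notin_seq (s ++ [seq - M.[z] / R.[z] | z <- r]).
rewrite mem_cat => /norP[cs cr]; exists c => //.
have sQ : size (M + c *: R) = size M.
  by rewrite size_polyDl // (leq_ltn_trans (size_scale_leq _ _)).
have Q0 : M + c *: R != 0 by rewrite -size_poly_eq0 sQ; lia.
rewrite unlock coprimep_def; apply: contraNT cr => /closed_rootP[z].
rewrite root_gcd => /andP[/rootP Qz /rootP dQz].
rewrite derivD derivZ !hornerE in Qz dQz.
have Rz : R.[z] != 0.
  apply: contra_eqN Qz => Rz; rewrite (eqP Rz) mulr0 addr0.
  by apply: contraTN Rz => Mz; apply: coMR.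
apply/mapP; exists z; last first.
  by rewrite (_ : M.[z] = - (c * R.[z])) ?opprK ?mulfK //; apply/eqP; rewrite -addr_eq0 Qz.
have : root (M^`() * R - M * R^`()) z.
  apply/rootP; rewrite !hornerE.
  have -> : M.[z] = - (c * R.[z]) by apply/eqP; rewrite -addr_eq0 Qz.
  have -> : M^`().[z] = - (c * R^`().[z]) by apply/eqP; rewrite -addr_eq0 dQz.
  by ring.
by rewrite eW rootZ ?lead_coef_eq0 // root_prod_XsubC.
Qed.

(** The weights cancel in [w k * Q.[a k]], leaving a constant times the Lagrange residue; the
    residue sums of ['X^j] vanish for [j < t < #|J|]. *)
Lemma separable_annihilator (w a : J -> F) n t :
  injective a -> (forall k, w k != 0) -> (t < #|J| <= n)%N ->
  exists Q : {poly F}, [/\ size Q = n.+1, separable_poly Q, forall k, Q.[a k] != 0 &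
    forall j, (j < t)%N -> \sum_k w k * Q.[a k] * a k ^+ j = 0].
Proof.
move=> ia w0 /andP[tJ Jn]; have aT : {in [set: J] &, injective a} by move=> x y _ _ /ia.
pose l k := (node_prod setT a k)^-1.
have l0 k : l k != 0 by rewrite invr_eq0 node_prod_neq0.
pose R := interpolant setT a (fun k => l k / w k).
have Rk k : R.[a k] = l k / w k by rewrite interpolant_node.
have Rk0 k : R.[a k] != 0 by rewrite Rk mulf_neq0 // invr_eq0.
have /card_gt0P[k0 _] : (0 < #|[set: J]|)%N by rewrite cardsT (leq_ltn_trans (leq0n t)).
pose A := \prod_(k in setT) ('X - (a k)%:P).
have Ak k : A.[a k] = 0 by rewrite horner_prod_XsubC_set (bigD1 k) ?inE //= subrr mul0r.
have A0 : A != 0 by rewrite -size_poly_eq0 size_prod_XsubC_set.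
have R0 : R != 0 by apply: contraNneq (Rk0 k0) => ->; rewrite horner0.
(* Since [u] is a zero of neither [A] nor [R], padding [A] with powers of ['X - u] reaches degree
   [n], keeps the nodes simple zeros of [M] and creates no common zero with [R]. *)
have [u] := closed_nonrootP _ (mulf_neq0 A0 R0); rewrite rootM negb_or => /andP[Au Ru].
pose U := ('X - u%:P) ^+ (n - #|J|); pose M := A * U.
have Uk k : U.[a k] != 0.
  rewrite horner_exp hornerXsubC expf_neq0 // subr_eq0.
  by apply: contraNneq Au => <-; apply/rootP.
have sM : size M = n.+1.
  rewrite size_mul ?expf_neq0 ?polyXsubC_eq0 // size_prod_XsubC_set size_exp_XsubC cardsT.
  by lia.
have sR : (size R <= #|J|)%N by rewrite -cardsT size_interpolant.
have coMR z : root M z -> ~~ root R z.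
  rewrite rootM => /orP[|]; last first.
    by rewrite /root horner_exp hornerXsubC expf_eq0 subr_eq0 => /andP[_ /eqP->].
  rewrite {1}/root horner_prod_XsubC_set => /(prodf_eq0 _ _) [k _].
  by rewrite subr_eq0 => /eqP->; apply/negP=> /rootP/eqP; apply/negP.
(* At [a k0], a simple zero of [M], the Wronskian reduces to its first term, which is nonzero
   there. *)
have W0 : M^`() * R - M * R^`() != 0.
  apply/negP=> /eqP/(congr1 (fun p => p.[a k0])); apply/eqP.
  rewrite !hornerE Ak !mul0r subr0 mulf_neq0 //.
  rewrite /M /A (bigD1 k0) ?inE //= !derivM derivXsubC !hornerE subrr !mul0r !addr0.
  apply: mulf_neq0; last by have := Uk k0; rewrite !hornerE.
  rewrite horner_prod; apply/prodf_neq0 => k /andP[_ k0k].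
  by rewrite hornerXsubC subr_eq0 (inj_eq ia) eq_sym.
(* Excluding [c = 0] keeps [Q] nonzero at the nodes, where [M] vanishes. *)
have [|c] := separable_pencil [:: 0] coMR W0; first by rewrite sM ltnS (leq_trans sR).
rewrite inE => c0 sepQ; have Qk k : (M + c *: R).[a k] = c * (l k / w k).
  by rewrite hornerD hornerZ hornerM Ak mul0r add0r Rk.
exists (M + c *: R); split=> // [|k|j jt].
- rewrite size_polyDl // sM ltnS; apply: leq_trans Jn.
  exact: leq_trans (size_scale_leq _ _) sR.
- by rewrite Qk -Rk mulf_neq0.
have res : \sum_(k in setT) ('X^j : {poly F}).[a k] / node_prod setT a k = 0.
  by apply: sum_residues => //; rewrite size_polyXn cardsT; lia.
rewrite -[RHS](mulr0 c) -[in RHS]res mulr_sumr /=; apply: eq_big => [k|k _]; first by rewrite inE.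
by rewrite Qk hornerXn -/(l k); move: (l k) (a k ^+ j) => y z; field; apply: w0.
Qed.

End ClosedField.

(** * The coded computing scheme *)

Lemma encoder_entry K q v (alpha : 'I_K -> CC) (X : 'I_K -> 'M[CC]_(q, v)) z i j :
  encoder alpha X z i j = (interpolant setT alpha (fun k => X k i j)).[z].
Proof.
rewrite horner_interpolant summxE; apply: eq_big => [k|k _]; first by rewrite inE.
by rewrite mxE; congr (_ * _); apply: eq_bigl => m; rewrite inE.
Qed.

(** Each entry of the encoded data is a polynomial [e] of size at most [K], so
    [weighted_interpolation] applies entrywise to [F \Po e]. *)
Lemma cpa_feasible_of_moments K N (F : {poly CC}) (w alpha : 'I_K -> CC)
    (beta : 'I_N -> CC) (P : {set {set 'I_N}}) c :
  injective alpha -> injective beta ->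
  (forall A, A \in P -> ((size F).-1 * (K - 1) < #|A| + c)%N) ->
  (forall A, A \in P -> forall j : nat, (j < c)%N ->
     \sum_(k < K) w k * (\prod_(n in A) (alpha k - beta n)) * alpha k ^+ j = 0) ->
  cpa_feasible F w alpha beta P.
Proof.
move=> ia ib szP mP q v X A AP; apply/matrixP=> i j.
pose e := interpolant setT alpha (fun k => X k i j).
have se : (size (F \Po e) <= #|A| + c)%N.
  apply: leq_trans (size_comp_poly_leq _ _) _; apply: leq_ltn_trans (szP A AP).
  rewrite leq_mul2l; apply/orP; right.
  have := size_interpolant setT alpha (fun k => X k i j).
  by rewrite cardsT card_ord -/e; case: (size e) => [|s]; lia.
have bA : {in A &, injective beta} by move=> m n _ _ /ib.
have := weighted_interpolation bA se (mP A AP).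
rewrite /cpa_output /cpa_target !summxE => h.
transitivity (\sum_k w k * (F \Po e).[alpha k]); last first.
  apply: eq_bigr => k _; rewrite !mxE horner_comp interpolant_node ?inE //.
  by move=> m n _ _ /ia.
rewrite -h; apply: eq_bigr => k _; rewrite mxE; congr (_ * _).
rewrite horner_interpolant summxE; apply: eq_bigr => n _.
by rewrite !mxE encoder_entry horner_comp.
Qed.

Theorem theorem2 (K d S N : nat) :
  (0 < K)%N -> (0 < d)%N -> (0 < S)%N -> (0 < N)%N ->
  (S + 2 <= N)%N -> (N <= d * (K - 1) + S)%N ->
  forall w : 'I_K -> CC, (forall k, w k != 0) ->
  let C := (d * (K - 1) + S + 1 - N)%N in
  exists p : {mpoly CC[K]}, p != 0 /\
  forall (P : {set {set 'I_N}}), is_pattern S P ->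
  let II := pattern_inter P in
  let I := #|II| in
  let L := (N - S - I)%N in
  forall alpha : 'I_K -> CC, injective alpha -> p.@[alpha] != 0 ->
  (* (1) *)
  ((exists beta : 'I_N -> CC,
      {in II &, injective beta} /\
      (forall n k, n \in II -> beta n != alpha k) /\
      (forall j : nat, (j < C + L)%N ->
         \sum_(k < K) w k * (\prod_(n in II) (alpha k - beta n)) * alpha k ^+ j = 0))
   <-> (Istar K d <= I)%N) /\
  (* (2) *)
  ((Istar K d <= I)%N ->
   exists beta : 'I_N -> CC,
     injective beta /\
     (forall n k, beta n != alpha k) /\
     (forall A, A \in P -> forall j : nat, (j < C)%N ->
        \sum_(k < K) w k * (\prod_(n in A) (alpha k - beta n)) * alpha k ^+ j = 0) /\
     (forall F : {poly CC}, size F = d.+1 -> cpa_feasible F w alpha beta P)).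
Proof.
(* The witness covers all orders at once, as it is chosen before the pattern and hence before
   [I]. *)
move=> K0 d0 S0 N0 SN NdKS w w0 C; exists (generic_poly w).
split=> [|P [P0 cardP] II I L alpha ia /generic_polyP[g1 g2]].
  exact: generic_poly_neq0.
have sII A : A \in P -> II \subset A by move=> AP; apply: bigcap_inf.
have IN : (I <= N - S)%N.
  by have [A AP] := set0Pn _ P0; rewrite -(cardP A AP) subset_leq_card ?sII.
have CL : (C + L = d * (K - 1) + 1 - I)%N by rewrite /C /L; lia.
have dK : (d * (K - 1) = (d - 1) * (K - 1) + (K - 1))%N.
  by rewrite -mulSnr; congr (_ * _)%N; lia.
have part1 : (exists beta : 'I_N -> CC,
      {in II &, injective beta} /\
      (forall n k, n \in II -> beta n != alpha k) /\
      (forall j : nat, (j < C + L)%N ->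
         \sum_(k < K) w k * (\prod_(n in II) (alpha k - beta n)) * alpha k ^+ j = 0))
   <-> (Istar K d <= I)%N.
  split=> [[beta [_ [ba bm]]]|Ige].
    rewrite leqNgt; apply/negP=> Ilt.
    have [KT|TK] := leqP K (C + L).
      have cK : (#|'I_K| <= C + L)%N by rewrite card_ord.
      have /eqP := moments_vanish ia cK bm (Ordinal K0).
      rewrite mulf_eq0 (negbTE (w0 _)); apply/negP/prodf_neq0 => n nI.
      by rewrite subr_eq0 eq_sym ba.
    (* For [d >= 2], [I <= (d - 1) * (K - 1)] would give [K <= C + L]. For [d = 1], [2 * I <= K - 1]
       gives [I + 1 <= K - I = C + L]. *)
    have [d1 [I1 IT]] : d = 1%N /\ (0 < I < C + L)%N /\ (I < K)%N.
      move: Ilt TK IN NdKS; rewrite CL /Istar; case: eqP => [->|d1].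
        by rewrite !mul1n; lia.
      by rewrite dK; lia.
    have [|/det_hankel_neq0P H _] := g1 I.+1; first by lia.
    have sP := size_prod_XsubC_set II beta.
    have /eqP : \prod_(n in II) ('X - (beta n)%:P) = 0.
      apply: H => [|j jI]; first by rewrite sP.
      have jT : (j < C + L)%N by lia.
      by rewrite -[RHS](bm j jT); apply: eq_bigr => k _; rewrite horner_prod_XsubC_set.
    by rewrite -size_poly_eq0 sP.
  have [Q [sQ sepQ Qa Qm]] : exists Q : {poly CC}, [/\ size Q = I.+1, separable_poly Q,
      forall k, Q.[alpha k] != 0 &
      forall j, (j < C + L)%N -> \sum_k w k * Q.[alpha k] * alpha k ^+ j = 0].
    move: Ige; rewrite /Istar; case: eqP => [d1|d1] Ige.
      (* From [S + 2 <= N <= K - 1 + S] one gets [K >= 3], so [1 < I < K]; moreover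
         [C + L = K - I <= I]. *)
      have [H sepH] : \det (hankel I w alpha) != 0 /\ separable_poly (orthopoly I w alpha).
        by apply: g1; move: NdKS; rewrite d1 mul1n; lia.
      exists (orthopoly I w alpha); split=> //.
      - exact: size_orthopoly.
      - move=> k; apply: orthopoly_node_neq0 => //; apply: g2.
        by move: NdKS; rewrite d1 mul1n; lia.
      move=> j jT; apply: orthopolyP; move: jT; rewrite CL d1 mul1n.
      by lia.
    (* The bound [I > (d - 1) * (K - 1)] gives both [C + L < K] and [K <= I]. *)
    apply: separable_annihilator => //; rewrite CL card_ord.
    have : (K - 1 <= (d - 1) * (K - 1))%N by apply: leq_pmull; lia.
    by move: NdKS; rewrite dK; lia.
  have [beta bi eQ] := separable_factor sQ sepQ.
  have lQ : lead_coef Q != 0 by rewrite lead_coef_eq0 -size_poly_eq0 sQ.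
  exists beta; split=> //; split=> [n k nI|j jT].
    apply: contraNneq (Qa k) => nk; rewrite eQ (bigD1 n) //= nk subrr mul0r.
    by rewrite mulr0.
  apply: (mulfI lQ); rewrite mulr0 -[RHS](Qm j jT) mulr_sumr.
  by apply: eq_bigr => k _; rewrite eQ !mulrA [w k * _]mulrC.
split=> // /part1[beta0 [b0i [b0a b0m]]].
have b0s n : n \in II -> beta0 n \notin [seq alpha k | k <- enum 'I_K].
  by move=> nI; apply/mapP=> -[k _]; apply/eqP/b0a.
have [beta [bi ba bE]] := extend_injection b0i b0s.
exists beta; split=> //; split=> [n k|].
  by apply: contraNneq (ba n) => ->; rewrite map_f ?mem_enum.
have mP A : A \in P -> forall j : nat, (j < C)%N ->
    \sum_(k < K) w k * (\prod_(n in A) (alpha k - beta n)) * alpha k ^+ j = 0.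
  (* The product over [A] is the one over [II] times one of degree [L]; absorbing the latter into
     the test monomial gives a polynomial of degree below [C + L]. *)
  move=> AP j jC; set r := \prod_(n in A :\: II) ('X - (beta n)%:P) * 'X^j.
  have sr : (size r <= C + L)%N.
    apply: leq_trans (size_polyMleq _ _) _; rewrite size_prod_XsubC_set size_polyXn.
    by rewrite cardsDS ?sII // cardP //= -/I /L; lia.
  rewrite -[RHS](moments_horner b0m sr); apply: eq_bigr => k _.
  rewrite hornerM hornerXn horner_prod_XsubC_set !mulrA; congr (_ * _).
  rewrite -mulrA; congr (_ * _); rewrite (big_setID II) /= (setIidPr (sII A AP)).
  by congr (_ * _); apply: eq_bigr => n nI; rewrite bE.
split=> // F sF; apply: (cpa_feasible_of_moments (c := C)) => // A AP.
by rewrite sF cardP // /C; lia.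
Qed.
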